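(* For every mixed fair division instance with two agents ($n=2$) and type-normalized additive valuations with $v_i(o)\in\{-1,0,1\}$ for every agent $i$ and item $o$, a (complete) allocation that is both EQ1 and Pareto optimal (PO) exists, and one can be computed in polynomial time.
   Context: A (mixed) fair division instance $([n],[m],\mathcal{V})$ consists of $n$ agents, a set $O=[m]$ of $m$ indivisible items, and valuations $\mathcal{V}=\{v_1,\dots,v_n\}$ with $v_i:2^{[m]}\to\mathbb{Z}$ additive: $v_i(S)=\sum_{o\in S}v_i(o)$. A (complete) allocation $A=(A_1,\dots,A_n)$ is a partition of the set of all items into $n$ (possibly empty) bundles, $A_i$ going to agent $i$. An instance is type-normalized if there are constants $g$ and $c$ such that for every agent $i$, $\sum_{o:\,v_i(o)\ge 0}v_i(o)=g$ and $\sum_{o:\,v_i(o)\le 0}v_i(o)=c$. An allocation $A$ is EQ1 (equitable up to one item) if for every pair of agents $i,j$ with $v_i(A_i)<v_j(A_j)$, either there exists $g\in A_j$ with $v_j(g)\ge 0$ such that $v_i(A_i)\ge v_j(A_j\setminus\{g\})$, or there exists $c\in A_i$ with $v_i(c)\le 0$ such that $v_i(A_i\setminus\{c\})\ge v_j(A_j)$. An allocation $A$ is Pareto optimal (PO) if there is no allocation $A'$ with $v_i(A'_i)\ge v_i(A_i)$ for all agents $i$ and $v_j(A'_j)>v_j(A_j)$ for at least one agent $j$. *)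

(* Defs.v *)
From HB Require Import structures.
From Corelib Require Import BinNums.
From mathcomp Require Import all_boot all_order all_algebra.

Set Implicit Arguments.
Unset Strict Implicit.
Unset Printing Implicit Defensive.

Import Order.TTheory GRing.Theory Num.Theory.
Local Open Scope ring_scope.

(** * Fair division *)

(* A profile [v : 'I_n -> {set 'I_m} -> int] gives agent i the set function
   [v i]; the value of a single item o is [v i [set o]]. *)
Definition additive_profile n m (v : 'I_n -> {set 'I_m} -> int) : Prop :=
  forall i (S : {set 'I_m}), v i S = \sum_(o in S) v i [set o].

Definition ternary_profile n m (v : 'I_n -> {set 'I_m} -> int) : Prop :=
  forall i o, v i [set o] \in [:: -1; 0; 1].

Definition type_normalized n m (v : 'I_n -> {set 'I_m} -> int) : Prop :=
  exists g c : int, forall i,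
    \sum_(o | 0 <= v i [set o]) v i [set o] = g /\
    \sum_(o | v i [set o] <= 0) v i [set o] = c.

(* Bundles may be empty, so this is not [finset.partition]. *)
Definition allocation n m (A : 'I_n -> {set 'I_m}) : Prop :=
  \bigcup_i A i = [set: 'I_m] /\
  (forall i j, i != j -> [disjoint A i & A j]).

Definition EQ1 n m (v : 'I_n -> {set 'I_m} -> int)
    (A : 'I_n -> {set 'I_m}) : Prop :=
  forall i j, v i (A i) < v j (A j) ->
    (exists g, [/\ g \in A j, 0 <= v j [set g] &
                   v i (A i) >= v j (A j :\ g)]) \/
    (exists c, [/\ c \in A i, v i [set c] <= 0 &
                   v i (A i :\ c) >= v j (A j)]).

Definition pareto_optimal n m (v : 'I_n -> {set 'I_m} -> int)
    (A : 'I_n -> {set 'I_m}) : Prop :=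
  ~ exists A' : 'I_n -> {set 'I_m},
      [/\ allocation A',
          forall i, v i (A' i) >= v i (A i) &
          exists j, v j (A' j) > v j (A j)].

(** * Deterministic multitape Turing machines *)

Inductive move := MoveL | Stay | MoveR.

Definition shift (d : move) : int :=
  match d with MoveL => -1 | Stay => 0 | MoveR => 1 end.

(* Cells hold [Some a] or the blank [None]. There are [work + 2] two-way
   infinite tapes: [ord0] is the input tape, [ord_max] the output tape. As the
   states and the scanned cells range over finite types, [delta] is a finite
   table. *)
Record turing_machine (Sigma : finType) := TuringMachine {
  work : nat;
  state : finType;
  start : state;
  halting : pred state;
  delta : state -> {ffun 'I_work.+2 -> option Sigma} ->
          state * ('I_work.+2 -> option Sigma * move) }.

Record config (Sigma : finType) (M : turing_machine Sigma) := Config {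
  cstate : state M;
  tape : 'I_(work M).+2 -> int -> option Sigma;
  head : 'I_(work M).+2 -> int }.

Definition step (Sigma : finType) (M : turing_machine Sigma) (C : config M) :
    config M :=
  if halting (cstate C) then C else
  let: (q, act) := delta (cstate C) [ffun k => tape C k (head C k)] in
  Config q
    (fun k x => if x == head C k then (act k).1 else tape C k x)
    (fun k => head C k + shift (act k).2).

Definition word_tape (Sigma : finType) (w : seq Sigma) (x : int) :
    option Sigma :=
  if x is Posz j then onth w j else None.

Definition initial (Sigma : finType) (M : turing_machine Sigma)
    (w : seq Sigma) : config M :=
  Config (start M)
    (fun k => if k == ord0 then word_tape w else fun=> None) (fun=> 0).

(* Halting configurations are fixed by [step], so this says that the machine
   halts after at most [t] steps. *)
Definition computes_within (Sigma : finType) (M : turing_machine Sigma)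
    (w u : seq Sigma) (t : nat) : Prop :=
  let C := iter t (@step Sigma M) (initial M w) in
  halting (cstate C) /\ tape C ord_max =1 word_tape u.

(** * Encodings *)

Inductive symbol := Zero | One | Minus | Comma | Semicolon.

Definition symbol_code (a : symbol) : 'I_5 :=
  match a with
  | Zero => inord 0 | One => inord 1 | Minus => inord 2
  | Comma => inord 3 | Semicolon => inord 4
  end.

Definition symbol_decode (k : 'I_5) : symbol :=
  nth Zero [:: Zero; One; Minus; Comma; Semicolon] k.

Lemma symbol_codeK : cancel symbol_code symbol_decode.
Proof. by case; rewrite /symbol_decode /= inordK. Qed.

HB.instance Definition _ := Finite.copy symbol (can_type symbol_codeK).

(* Binary notation, most significant digit first. *)
Fixpoint encode_pos (p : positive) : seq symbol :=
  match p with
  | xH => [:: One]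
  | xO q => rcons (encode_pos q) Zero
  | xI q => rcons (encode_pos q) One
  end.

Definition encode_nat (k : nat) : seq symbol :=
  if bin_of_nat k is Npos p then encode_pos p else [:: Zero].

Definition encode_int (z : int) : seq symbol :=
  (if z < 0 then [:: Minus] else [::]) ++ encode_nat `|z|%N.

(* The matrix of item values, item by item: "v_1(o),v_2(o),...,v_n(o),;" for
   each item o. *)
Definition encode_profile n m (v : 'I_n -> {set 'I_m} -> int) : seq symbol :=
  flatten [seq rcons (flatten [seq rcons (encode_int (v i [set o])) Comma
                              | i <- enum 'I_n]) Semicolon
          | o <- enum 'I_m].

(* The membership matrix, item by item: for each item o, the n bits telling
   whether o belongs to A_1, ..., A_n, then a semicolon. *)
Definition encode_allocation n m (A : 'I_n -> {set 'I_m}) : seq symbol :=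
  flatten [seq rcons [seq if o \in A i then One else Zero | i <- enum 'I_n]
                     Semicolon
          | o <- enum 'I_m].

(* Main.v *)
From HB Require Import structures.
Require Import Defs.
From mathcomp Require Import all_boot all_order all_algebra.
From mathcomp Require Import ring zify.

Import Order.TTheory GRing.Theory Num.Theory.
Local Open Scope ring_scope.

(** Give every item to the agent valuing it more; items of value (1, 1) are
    dealt alternately, starting with agent 0, and so are items of value
    (-1, -1). The sum of the two utilities is then maximal, which implies
    Pareto optimality. A non-tied item of value (a, b) changes the difference of
    the utilities by [a = 1] - [b = 1]; these changes cancel because both agents
    have the same number of items of value 1. Hence the difference is that of two alternating
    sums, which lies in {-1, 0, 1}, and when it is not 0, agent 0 holds a (1, 1)
    or (-1, -1) item whose removal restores balance. The rule only remembers
    whose turn it is in each of the two alternations, so a finite transducer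
    computes the allocation in a single pass. *)

Set Implicit Arguments.
Unset Strict Implicit.
Unset Printing Implicit Defensive.

(** * Finite transducers as Turing machines *)

Section Transducer.

Variables (Sigma Q : finType) (q0 : Q) (next : Q -> Sigma -> Q * option Sigma).

Fixpoint transduce (q : Q) (w : seq Sigma) : seq Sigma :=
  if w is a :: w' then
    if (next q a).2 is Some b then b :: transduce (next q a).1 w'
    else transduce (next q a).1 w'
  else [::].

(* State [None] is the halting one. The output head always scans a blank cell,
   so writing [None] on it is harmless. *)
Definition transducer : turing_machine Sigma :=
  @TuringMachine Sigma 0 (option Q) (Some q0) (fun q => ~~ isSome q)
    (fun q s =>
       match q, s ord0 with
       | Some q, Some a =>
           (Some (next q a).1,
            fun k => if k == ord0 then (Some a, MoveR) else
                     if (next q a).2 is Some b then (Some b, MoveR)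
                     else (None, Stay))
       | _, _ => (None, fun k => (s k, Stay))
       end).

Lemma onth_size_cat (T : Type) (u w : seq T) : onth (u ++ w) (size u) = ohead w.
Proof. by elim: u => //=; case: w. Qed.

Lemma word_tape_rcons (u : seq Sigma) b x :
  word_tape (rcons u b) x =
    if x == (size u)%:Z then Some b else word_tape u x.
Proof.
case: x => // j; rewrite /= eqz_nat.
by elim: u j => [|c u IHu] [|j] //=; case: j.
Qed.

(** Induction on the unread input [w], with [u] already read and [out] already written; generalizing
    both is what lets the induction go through. The extra step reads the blank after the input and
    enters the halting state. *)
Lemma transducer_run q u w out (C : config transducer) :
    cstate C = Some q ->
    tape C ord0 =1 word_tape (u ++ w) -> Defs.head C ord0 = (size u)%:Z ->
    tape C ord_max =1 word_tape out -> Defs.head C ord_max = (size out)%:Z ->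
  let C' := iter (size w).+1 (@step Sigma transducer) C in
  halting (cstate C') /\ tape C' ord_max =1 word_tape (out ++ transduce q w).
Proof.
elim: w q u out C => [|a w IHw] q u out C Cq tape0 head0 tape1 head1.
  rewrite /= /step Cq /= ffunE head0 tape0 /= onth_size_cat cats0; split=> // x.
  by rewrite /= ffunE; case: eqP => [->|_]; rewrite tape1.
have scan0 : tape C ord0 (Defs.head C ord0) = Some a.
  by rewrite head0 tape0 /= onth_size_cat.
have sizeS (T : Type) (s : seq T) b : (size s)%:Z + 1 = (size (rcons s b))%:Z.
  by rewrite size_rcons -addn1 PoszD.
have blank1 : tape C ord_max (Defs.head C ord_max) = None.
  by rewrite head1 tape1 /= -[out in onth out]cats0 onth_size_cat.
have tape0' : (fun x => if x == Defs.head C ord0 then Some a else tape C ord0 x)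
    =1 word_tape (rcons u a ++ w).
  by move=> x; rewrite cat_rcons -tape0; case: eqP => // ->.
rewrite [size _]/= iterSr {2}/step Cq /= ffunE scan0 /=.
case next_q: (next q a) => [q' [b|]] /=; rewrite -?cat_rcons;
  apply: (IHw q' (rcons u a)) => //=; rewrite ?head0 ?head1 ?sizeS ?addr0 //.
- by move=> x; rewrite word_tape_rcons tape1.
- by move=> x; rewrite -tape1 -head1; case: eqP => // ->.
Qed.

Lemma transducer_computes w :
  computes_within transducer w (transduce q0 w) (size w).+1.
Proof. by apply: (@transducer_run q0 [::] w [::]) => //; case=> [[]|]. Qed.

End Transducer.

(** * The allocation rule *)

(* The two turns tell whether agent 0 receives the next (1, 1) item and the
   next (-1, -1) item; the last component, whether it receives this one. *)
Definition deal (s : bool * bool) (a b : int) : bool * bool * bool :=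
  if a == b then
    if 0 < a then (~~ s.1, s.2, s.1) else
    if a < 0 then (s.1, ~~ s.2, s.2) else (s, true)
  else (s, b < a).

Definition ternary (a : int) := a \in [:: -1; 0; 1].

Lemma ternaryP (P : int -> Prop) :
  P (-1) -> P 0 -> P 1 -> forall a, ternary a -> P a.
Proof. by move=> Pm P0 P1 a; rewrite /ternary !inE => /or3P[] /eqP->. Qed.

Lemma deal_max s a b : (if (deal s a b).2 then a else b) = Num.max a b.
Proof.
by rewrite /deal; case: (ltgtP a b) => [||->] //=; rewrite if_same.
Qed.

(** The turns act as a potential: a tied nonzero item changes the difference by the change of its
    turn, with opposite signs for goods and chores. Otherwise the larger value is 0 or 1 and the
    smaller at most 0, so the indicators alone account for it. *)
Lemma deal_balance (s : bool * bool) a b : ternary a -> ternary b ->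
  (if (deal s a b).2 then a else - b) =
    ((0 < a)%R%:Z - (0 < b)%R%:Z) + (s.1%:Z - (deal s a b).1.1%:Z)
    + ((deal s a b).1.2%:Z - s.2%:Z).
Proof.
by move=> ta tb; case: s => -[] []; elim/ternaryP: a / ta; elim/ternaryP: b / tb.
Qed.

Lemma deal_flip1 (s : bool * bool) a b : ternary a -> ternary b ->
  s.1 -> ~~ (deal s a b).1.1 -> [/\ (deal s a b).2, a = 1 & b = 1].
Proof.
by move=> ta tb; case: s => -[] []; elim/ternaryP: a / ta; elim/ternaryP: b / tb.
Qed.

Lemma deal_flip2 (s : bool * bool) a b : ternary a -> ternary b ->
  s.2 -> ~~ (deal s a b).1.2 -> [/\ (deal s a b).2, a = -1 & b = -1].
Proof.
by move=> ta tb; case: s => -[] []; elim/ternaryP: a / ta; elim/ternaryP: b / tb.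
Qed.

Section Dealing.

Variables a b : nat -> int.
Hypotheses (ta : forall k, ternary (a k)) (tb : forall k, ternary (b k)).

Fixpoint turns (n : nat) : bool * bool :=
  if n is k.+1 then (deal (turns k) (a k) (b k)).1 else (true, true).

Definition dealt (k : nat) : bool := (deal (turns k) (a k) (b k)).2.

Lemma dealt_balance n :
  \sum_(k < n) (if dealt k then a k else - b k) =
    \sum_(k < n) (0 < a k)%R%:Z - \sum_(k < n) (0 < b k)%R%:Z
    + ((turns n).2%:Z - (turns n).1%:Z).
Proof.
elim: n => [|n IHn]; first by rewrite !big_ord0.
rewrite !big_ord_recr /= IHn [X in _ + X = _]deal_balance //.
by ring.
Qed.

(** Turns start at [true], so a [false] one must have flipped, which happens only when agent 0
    receives a tied item. That item will be the EQ1 witness. *)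
Lemma turn1_flipped n : ~~ (turns n).1 ->
  exists k, [/\ (k < n)%N, dealt k, a k = 1 & b k = 1].
Proof.
elim: n => //= n IHn flip; case: (boolP (turns n).1) => [turn|/IHn].
  by have [] := deal_flip1 (ta n) (tb n) turn flip; exists n.
by case=> k [lt_kn ? ? ?]; exists k; split=> //; apply: ltnW.
Qed.

Lemma turn2_flipped n : ~~ (turns n).2 ->
  exists k, [/\ (k < n)%N, dealt k, a k = -1 & b k = -1].
Proof.
elim: n => //= n IHn flip; case: (boolP (turns n).2) => [turn|/IHn].
  by have [] := deal_flip2 (ta n) (tb n) turn flip; exists n.
by case=> k [lt_kn ? ? ?]; exists k; split=> //; apply: ltnW.
Qed.

End Dealing.

(** * Computing the rule by a transducer *)

(* [First neg] and [Second a neg] read a value whose minus sign has been seen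
   iff [neg]; [Rest w] is reached once the recipient of the item is known and
   its first output bit is written. *)
Inductive phase := First of bool | Second of bool * bool & bool | Rest of bool.

Definition phase_code (p : phase) : bool + (bool * bool * bool + bool) :=
  match p with
  | First neg => inl neg
  | Second a neg => inr (inl (a, neg))
  | Rest w => inr (inr w)
  end.

Definition phase_decode (c : bool + (bool * bool * bool + bool)) : phase :=
  match c with
  | inl neg => First neg
  | inr (inl (a, neg)) => Second a neg
  | inr (inr w) => Rest w
  end.

Lemma phase_codeK : cancel phase_code phase_decode. Proof. by case. Qed.

HB.instance Definition _ := Finite.copy phase (can_type phase_codeK).

Definition digit (neg one : bool) : int :=
  if one then if neg then -1 else 1 else 0.

Definition bit (w : bool) : symbol := if w then One else Zero.

Definition deal_digit (s : bool * bool) (p : phase) (one : bool) :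
    bool * bool * phase * option symbol :=
  match p with
  | First neg => (s, Second (neg, one) false, None)
  | Second (neg1, one1) neg =>
      let: (s', w) := deal s (digit neg1 one1) (digit neg one) in
      (s', Rest w, Some (bit w))
  | Rest _ => (s, p, None)
  end.

(** A ternary value has a single digit, so the digit already ends it and the first comma is skipped.
    A transition writes at most one symbol, hence the second bit waits for the second comma. *)
Definition deal_next (q : bool * bool * phase) (c : symbol) :
    bool * bool * phase * option symbol :=
  let: (s, p) := q in
  match c, p with
  | Zero, _ => deal_digit s p false
  | One, _ => deal_digit s p true
  | Minus, First _ => (s, First true, None)
  | Minus, Second a _ => (s, Second a true, None)
  | Comma, Rest w => (s, p, Some (bit (~~ w)))
  | Semicolon, Rest _ => (s, First false, Some Semicolon)
  | _, _ => (q, None)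
  end.

Definition encode_item (a b : int) : seq symbol :=
  encode_int a ++ Comma :: encode_int b ++ [:: Comma; Semicolon].

Lemma transduce_item s a b w : ternary a -> ternary b ->
  transduce deal_next (s, First false) (encode_item a b ++ w) =
    [:: bit (deal s a b).2, bit (~~ (deal s a b).2), Semicolon &
        transduce deal_next ((deal s a b).1, First false) w].
Proof.
by move=> ta tb; case: s => -[] []; elim/ternaryP: a / ta; elim/ternaryP: b / tb.
Qed.

Lemma transduce_items a b n k :
    (forall j, ternary (a j)) -> (forall j, ternary (b j)) ->
  transduce deal_next (turns a b k, First false)
      (flatten [seq encode_item (a j) (b j) | j <- iota k n]) =
    flatten [seq [:: bit (dealt a b j); bit (~~ dealt a b j); Semicolon]
            | j <- iota k n].
Proof.
move=> ta tb; elim: n k => //= n IHn k.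
by rewrite transduce_item // (IHn k.+1).
Qed.

(** * Two-agent allocations *)

Lemma ord2P (P : 'I_2 -> Prop) : P ord0 -> P ord_max -> forall i, P i.
Proof.
move=> P0 P1 [[|[|//]] lti]; [move: P0 | move: P1];
  by congr (P _); apply: val_inj.
Qed.

Lemma enum_ord2 : enum 'I_2 = [:: ord0; ord_max].
Proof. by apply: (inj_map val_inj); rewrite val_enum_ord. Qed.

Lemma allocation2_compl m (A : 'I_2 -> {set 'I_m}) :
  allocation A -> A ord_max = ~: A ord0.
Proof.
case=> coverA /(_ ord0 ord_max isT) disjA; apply/setP=> o; rewrite inE.
have : o \in \bigcup_i A i by rewrite coverA.
rewrite big_ord_recl big_ord1 inE (_ : lift _ _ = ord_max); last exact: val_inj.
by have /setDidPl/setP/(_ o) := disjA; rewrite !inE; do 2!case: (o \in _).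
Qed.

Definition dealt_allocation m (w : nat -> bool) (i : 'I_2) : {set 'I_m} :=
  [set o : 'I_m | w o == (i == ord0)].

Lemma dealt_allocationP m w : allocation (dealt_allocation m w).
Proof.
split.
  apply/setP=> o; rewrite inE; apply/bigcupP.
  by case wo: (w o); [exists ord0 | exists ord_max]; rewrite // inE wo.
move=> i j neq_ij; apply/pred0P=> o /=; rewrite !inE; move: neq_ij.
by elim/ord2P: i; elim/ord2P: j => //= _; case: (w o).
Qed.

Lemma encode_dealt_allocation m w :
  encode_allocation (dealt_allocation m w) =
    flatten [seq [:: bit (w k); bit (~~ w k); Semicolon] | k <- iota 0 m].
Proof.
rewrite /encode_allocation enum_ord2 -val_enum_ord -map_comp.
by congr flatten; apply: eq_map => o /=; rewrite !inE /=; case: (w o).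
Qed.

Section TwoAgents.

Variables (m : nat) (v : 'I_2 -> {set 'I_m} -> int).
Hypotheses (addv : additive_profile v) (ternv : ternary_profile v).
Hypothesis normv : type_normalized v.

(* Indexing items by [nat], with junk value 0 from [m] on, allows [m = 0]. *)
Definition item_value (i : 'I_2) (k : nat) : int :=
  oapp (fun o : 'I_m => v i [set o]) 0 (insub k).

Lemma item_valueE i (o : 'I_m) : item_value i o = v i [set o].
Proof. by rewrite /item_value valK. Qed.

Lemma ternary_item_value i k : ternary (item_value i k).
Proof. by rewrite /item_value; case: insub => //= o; apply: ternv. Qed.

Local Notation a := (item_value ord0).
Local Notation b := (item_value ord_max).
Local Notation w := (dealt a b).
Local Notation A := (dealt_allocation m w).

Lemma encode_profile2 :
  encode_profile v = flatten [seq encode_item (a k) (b k) | k <- iota 0 m].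
Proof.
rewrite /encode_profile enum_ord2 -val_enum_ord -map_comp.
congr flatten; apply: eq_map => o /=.
by rewrite !item_valueE cats0 rcons_cat cat_rcons -!cats1 -catA.
Qed.

Lemma item_removed i (S : {set 'I_m}) o :
  o \in S -> v i (S :\ o) = v i S - item_value i o.
Proof.
move=> So; rewrite addv [v i S]addv (big_setD1 o So) /= item_valueE.
by rewrite addrAC subrr add0r -addv.
Qed.

Lemma utility_sum (B : 'I_2 -> {set 'I_m}) : allocation B ->
  v ord0 (B ord0) + v ord_max (B ord_max) =
    \sum_(o < m) (if o \in B ord0 then a o else b o).
Proof.
move/allocation2_compl=> ->; rewrite !addv big_mkcond [X in _ + X]big_mkcond.
rewrite -big_split; apply: eq_bigr => o _ /=; rewrite inE !item_valueE.
by case: (o \in _); rewrite ?addr0 ?add0r.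
Qed.

Lemma utility_difference :
  v ord0 (A ord0) - v ord_max (A ord_max) =
    (turns a b m).2%:Z - (turns a b m).1%:Z.
Proof.
(* For ternary values, the normalized sum of nonnegative values counts the items of value 1. *)
have positives i : \sum_(o < m) (0 < item_value i o)%R%:Z =
    \sum_(o | 0 <= v i [set o]) v i [set o].
  rewrite [RHS]big_mkcond; apply: eq_bigr => o _; rewrite -item_valueE.
  by elim/ternaryP: (item_value i o) / (ternary_item_value i o).
have [g [c norm]] := normv.
have eq_positives :
    \sum_(o < m) (0 < a o)%R%:Z - \sum_(o < m) (0 < b o)%R%:Z = 0.
  by rewrite !positives (norm ord0).1 (norm ord_max).1 subrr.
rewrite -[RHS]add0r -[X in _ = X + _]eq_positives.
rewrite -dealt_balance; try exact: ternary_item_value.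
rewrite !addv big_mkcond [X in _ - X]big_mkcond -sumrB; apply: eq_bigr => o _.
by rewrite !inE !item_valueE; case: (w o); rewrite /= ?subr0 ?sub0r.
Qed.

Lemma dealt_pareto_optimal : pareto_optimal v A.
Proof.
case=> B [allB geB [j gtB]].
have : v ord0 (B ord0) + v ord_max (B ord_max) <=
       v ord0 (A ord0) + v ord_max (A ord_max).
  rewrite !utility_sum //; last exact: dealt_allocationP.
  (* Itemwise, the rule realizes the maximum of the two values. *)
  apply: ler_sum => o _; rewrite inE eqb_id deal_max le_max.
  by case: ifP => _; rewrite lexx ?orbT.
apply/negP; rewrite -ltNge; elim/ord2P: j gtB => gtB.
  exact: ltr_leD.
exact: ler_ltD.
Qed.

Lemma dealt_EQ1 : EQ1 v A.
Proof.
have ta := ternary_item_value ord0; have tb := ternary_item_value ord_max.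
have diff := utility_difference.
move=> i j; elim/ord2P: i; elim/ord2P: j; rewrite ?ltxx // => lt_ij.
(* Agent 0 is behind by exactly 1, so the chore turn has flipped; dropping a chore of agent 0 gives
   equality. *)
- have [|k [lt_km wk ak _]] := turn2_flipped (n := m) ta tb.
    by move: diff lt_ij; case: (turns a b m) => -[] [] /=; lia.
  right; exists (Ordinal lt_km); have Ao : Ordinal lt_km \in A ord0.
    by rewrite inE eqb_id.
  rewrite item_removed // -item_valueE /= ak; split=> //.
  by move: diff; case: (turns a b m) => -[] [] /=; lia.
(* Agent 0 is ahead by exactly 1, so the goods turn has flipped; dropping a good of agent 0 gives
   equality. *)
- have [|k [lt_km wk ak _]] := turn1_flipped (n := m) ta tb.
    by move: diff lt_ij; case: (turns a b m) => -[] [] /=; lia.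
  left; exists (Ordinal lt_km); have Ao : Ordinal lt_km \in A ord0.
    by rewrite inE eqb_id.
  rewrite item_removed // -item_valueE /= ak; split=> //.
  by move: diff; case: (turns a b m) => -[] [] /=; lia.
Qed.

Lemma dealt_computed :
  computes_within (transducer (true, true, First false) deal_next)
    (encode_profile v) (encode_allocation A) (size (encode_profile v)).+1.
Proof.
rewrite encode_dealt_allocation -transduce_items; try exact: ternary_item_value.
by rewrite -encode_profile2; apply: transducer_computes.
Qed.

End TwoAgents.

Theorem theorem5p7 :
  (forall (m : nat) (v : 'I_2 -> {set 'I_m} -> int),
     additive_profile v -> ternary_profile v -> type_normalized v ->
     exists A : 'I_2 -> {set 'I_m},
       [/\ allocation A, EQ1 v A & pareto_optimal v A])
  /\
  (exists (M : turing_machine symbol) (p : {poly nat}),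
     forall (m : nat) (v : 'I_2 -> {set 'I_m} -> int),
       additive_profile v -> ternary_profile v -> type_normalized v ->
       exists A : 'I_2 -> {set 'I_m},
         [/\ allocation A, EQ1 v A, pareto_optimal v A &
             computes_within M (encode_profile v) (encode_allocation A)
               p.[size (encode_profile v)]]).
Proof.
suff [M [p computed]] : exists (M : turing_machine symbol) (p : {poly nat}),
    forall (m : nat) (v : 'I_2 -> {set 'I_m} -> int),
      additive_profile v -> ternary_profile v -> type_normalized v ->
      exists A : 'I_2 -> {set 'I_m},
        [/\ allocation A, EQ1 v A, pareto_optimal v A &
            computes_within M (encode_profile v) (encode_allocation A)
              p.[size (encode_profile v)]].
  split; last by exists M, p.
  move=> m v addv ternv normv.
  by have [A []] := computed m v addv ternv normv; exists A.
(* One step per input symbol, plus one to halt. *)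
exists (transducer (true, true, First false) deal_next), ('X + 1%:P).
move=> m v addv ternv normv.
exists (dealt_allocation m (dealt (item_value v ord0) (item_value v ord_max))).
split; [exact: dealt_allocationP | exact: dealt_EQ1 |
        exact: dealt_pareto_optimal |].
by rewrite hornerD hornerX hornerC [X in computes_within _ _ _ X]addn1;
  apply: dealt_computed.
Qed.
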